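(* Let $\Bbbk$ be a field. The ring $V_{(3,4,5),6}$ does not admit a determinantal presentation.
   Context: $V_{(3,4,5),6}=\bigoplus_{i\ge0}R_{6i}$ where $R=\Bbbk[x_1,x_2,x_3]$ is graded by $\deg x_1=3$, $\deg x_2=4$, $\deg x_3=5$; i.e. it is the $\Bbbk$-span of all monomials $x_1^{u_1}x_2^{u_2}x_3^{u_3}$ with $6\mid 3u_1+4u_2+5u_3$. A subring $S$ of a polynomial ring that is generated by monomials, with minimal monomial $\Bbbk$-algebra generators $m_1,\ldots,m_s$, admits a determinantal presentation if the kernel of the surjection $\Bbbk[t_1,\ldots,t_s]\to S$, $t_i\mapsto m_i$, equals the ideal $I_2(M)$ of $2\times2$ minors of some matrix $M$ whose entries are nonconstant monomials in $t_1,\ldots,t_s$. *)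

(* Defs.v *)
From mathcomp Require Import all_boot all_order all_algebra.
From mathcomp Require Export mpoly.

Set Implicit Arguments.
Unset Strict Implicit.
Unset Printing Implicit Defensive.

Import GRing.Theory.
Local Open Scope ring_scope.

Definition wdeg n (a : n.-tuple nat) (u : 'X_{1..n}) : nat :=
  (\sum_(i < n) tnth a i * u i)%N.

(* A polynomial lies in the span of a set of monomials exactly when its support
   is contained in that set. *)
Definition veronese (K : fieldType) n (a : n.-tuple nat) (d : nat) :
    {pred {mpoly K[n]}} :=
  [pred f | all (fun u => d %| wdeg a u)%N (msupp f)].
Arguments veronese K {n} a d.

Definition monomial_map (K : fieldType) n s (m : s.-tuple 'X_{1..n})
    (f : {mpoly K[s]}) : {mpoly K[n]} :=
  f \mPo [tuple 'X_[tnth m i] | i < s].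

Definition mon_generates (K : fieldType) n (S : {pred {mpoly K[n]}}) s
    (m : s.-tuple 'X_{1..n}) : Prop :=
  forall p, p \in S <-> exists f, p = monomial_map m f.

(* Taking m' to be m with one occurrence of a repeated entry removed shows that
   the entries of a minimal m are pairwise distinct. *)
Definition min_mon_generates (K : fieldType) n (S : {pred {mpoly K[n]}}) s
    (m : s.-tuple 'X_{1..n}) : Prop :=
  mon_generates S m /\
  forall s' (m' : s'.-tuple 'X_{1..n}),
    subseq m' m -> mon_generates S m' -> m' = m :> seq _.

Definition ideal_gen (R : comNzRingType) (G : R -> Prop) (x : R) : Prop :=
  exists (n : nat) (c g : 'I_n -> R),
    (forall i, G (g i)) /\ x = \sum_(i < n) c i * g i.

Definition is_minor (R : comNzRingType) (r p q : nat) (M : 'M[R]_(p, q))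
    (x : R) : Prop :=
  exists (f : 'I_r -> 'I_p) (g : 'I_r -> 'I_q),
    [/\ {homo f : i j / (i < j)%N}, {homo g : i j / (i < j)%N}
      & x = \det (mxsub f g M)].

Definition det_ideal (R : comNzRingType) (r p q : nat) (M : 'M[R]_(p, q)) :
    R -> Prop :=
  ideal_gen (is_minor r M).

Definition nonconstant_monomial (K : fieldType) s (f : {mpoly K[s]}) : Prop :=
  exists2 u : 'X_{1..s}, u != 0%MM & f = 'X_[u].

Definition admits_determinantal_presentation (K : fieldType) n
    (S : {pred {mpoly K[n]}}) : Prop :=
  exists (s : nat) (m : s.-tuple 'X_{1..n}),
    min_mon_generates S m /\
    exists (p q : nat) (M : 'M[{mpoly K[s]}]_(p, q)),
      (forall i j, nonconstant_monomial (M i j)) /\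
      (forall f : {mpoly K[s]}, monomial_map m f = 0 <-> det_ideal 2 M f).

(* Main.v *)
(* In x-exponents, the Veronese ring has among its minimal generators
   A = (2,0,0), B = (0,3,0), C = (1,1,1), D = (0,2,2), E = (1,0,3).  If M is a
   determinantal presentation, the images w(i,j) of its entries satisfy
   w(i,j) + w(i',j') = w(i,j') + w(i',j).  The relations AD = C^2 and BE = CD
   are quadratic and involve all the factorisations of the corresponding
   monomials, so they are minors of M.  The first one gives
   w(i,j) = A and w(i,j') = w(i',j) = C, the second one an entry w(k,l) = B.
   Since A + B = w(i,l) + w(k,j) has no other nontrivial splitting, one of
   w(i,l), w(k,j) is B.  Moving from column j to column j', resp. from row i to
   row i', adds C - A = (-1,1,1), which cannot be added to B. *)
Require Import Defs.
From mathcomp Require Import all_boot all_order all_algebra mpoly zify.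

Set Implicit Arguments.
Unset Strict Implicit.
Unset Printing Implicit Defensive.

Import GRing.Theory.
Local Open Scope ring_scope.

(** * Exponent vectors and supports *)

Lemma mnm_neq0P n (u : 'X_{1..n}) :
  u != 0%MM -> exists i v, u = (U_(i) + v)%MM.
Proof.
move=> u0; have [i ui] : exists i, u i != 0%N.
  apply/existsP; rewrite -negb_forall; apply: contraNN u0 => /forallP u0.
  by apply/eqP/mnmP => i; rewrite mnm0E; apply/eqP.
by exists i, (u - U_(i))%MM; rewrite addmC submK ?lep1mP.
Qed.

Lemma mnmD_eq0 n (u v : 'X_{1..n}) : (u + v = 0)%MM -> u = 0%MM.
Proof.
move=> /mnmP uv; apply/mnmP => i; apply/eqP; move: (uv i).
by rewrite mnmDE mnm0E => /eqP; rewrite addn_eq0 => /andP[].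
Qed.

Lemma mcoeffMX_neq0 (R : nzRingType) n (f : {mpoly R[n]}) u v :
  (f * 'X_[u])@_v != 0 -> (u <= v)%MM.
Proof.
rewrite -mcoeff_msupp (perm_mem (msuppMX _ _)) => /mapP[w _ ->].
exact: lem_addr.
Qed.

(** * Monomial maps on exponents *)

Section MonomialMap.
Context (K : fieldType) (n s : nat) (m : s.-tuple 'X_{1..n}).

(** The additive map on exponents that [monomial_map m] induces. *)
Definition exp_map (u : 'X_{1..s}) : 'X_{1..n} :=
  (\sum_(i < s) (tnth m i *+ u i))%MM.

Lemma exp_mapE u j : exp_map u j = (\sum_(i < s) tnth m i j * u i)%N.
Proof. by rewrite mnm_sumE; apply: eq_bigr => i _; rewrite mulmnE. Qed.

Lemma exp_map0 : exp_map 0%MM = 0%MM.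
Proof.
by apply/mnmP => j; rewrite exp_mapE mnm0E big1 // => i _; rewrite mnm0E muln0.
Qed.

Lemma exp_mapD u v : exp_map (u + v)%MM = (exp_map u + exp_map v)%MM.
Proof.
apply/mnmP => j; rewrite mnmDE !exp_mapE -big_split /=.
by apply: eq_bigr => i _; rewrite mnmDE mulnDr.
Qed.

Lemma exp_map1 i : exp_map U_(i)%MM = tnth m i.
Proof.
apply/mnmP => j; rewrite exp_mapE (bigD1 i) //= mnm1E eqxx muln1 big1 ?addn0 //.
by move=> k /negPf ki; rewrite mnm1E eq_sym ki muln0.
Qed.

Lemma monomial_mapX u :
  monomial_map m 'X_[u] = 'X_[exp_map u] :> {mpoly K[n]}.
Proof.
rewrite /monomial_map comp_mpolyX /exp_map.
rewrite (big_morph (fun v => 'X_[v] : {mpoly K[n]})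
  (@mpolyXD _ _) (@mpolyX0 _ _)).
by apply: eq_bigr => i _; rewrite tnth_mktuple mpolyXn.
Qed.

Lemma monomial_mapE (f : {mpoly K[s]}) :
  monomial_map m f = \sum_(u <- msupp f) f@_u *: 'X_[exp_map u].
Proof.
rewrite {1}(mpolyE f) /monomial_map raddf_sum /=.
by apply: eq_bigr => u _; rewrite comp_mpolyZ -monomial_mapX.
Qed.

Lemma monomial_map_binomial_eq0 u v :
  monomial_map m ('X_[u] - 'X_[v] : {mpoly K[s]}) = 0 <->
  exp_map u = exp_map v.
Proof.
rewrite /monomial_map raddfB /= -!/(monomial_map _ _) !monomial_mapX.
split=> [/eqP|->]; last by rewrite subrr.
rewrite subr_eq0 => /eqP /(congr1 (fun f : {mpoly K[n]} => f@_(exp_map v))).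
rewrite !mcoeffX eqxx; case: eqP => // _ /eqP.
by rewrite eq_sym oner_eq0.
Qed.

(** Compare coefficients at [a] in a preimage expression of ['X_[a]]: if no exponent of [f] mapped
    to [a], this would read 1 = 0. *)
Lemma mem_exp_map (S : {pred {mpoly K[n]}}) (a : 'X_{1..n}) :
  mon_generates S m -> 'X_[a] \in S -> exists u, exp_map u = a.
Proof.
move=> gen /gen[f /(congr1 (fun g : {mpoly K[n]} => g@_a))].
rewrite mcoeffX eqxx monomial_mapE raddf_sum /= => sum1.
have [[u _ /eqP]|nu] := altP (@hasP _ (fun u => exp_map u == a) (msupp f)).
  by exists u.
move: sum1; rewrite big1_seq => [/eqP|u /= uf]; first by rewrite oner_eq0.
rewrite mcoeffZ mcoeffX; have [ua|_] := eqVneq; last by rewrite mulr0.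
by case/hasP: nu; exists u; rewrite ?ua.
Qed.

End MonomialMap.

(** * Minimal monomial generators *)

Section Generators.
Context (K : fieldType) (n : nat) (S : {pred {mpoly K[n]}}).

(** Substitute for each variable a monomial with the same image under [m']; a trivial generator is
    replaced by 1. *)
Lemma monomial_map_factor s s' (m : s.-tuple 'X_{1..n})
    (m' : s'.-tuple 'X_{1..n}) :
    (forall x, x \in m -> x = 0%MM \/ x \in m') ->
  forall f : {mpoly K[s]}, exists f', monomial_map m f = monomial_map m' f'.
Proof.
move=> mm' f.
have /fin_all_exists[v vE] i : exists v, exp_map m' v = tnth m i.
  have [->|/tnthP[j ->]] := mm' _ (mem_tnth i m).
    by exists 0%MM; rewrite exp_map0.
  by exists U_(j)%MM; rewrite exp_map1.
pose h (u : 'X_{1..s}) := (\sum_(i < s) (v i *+ u i))%MM.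
exists (\sum_(u <- msupp f) f@_u *: 'X_[h u]).
rewrite monomial_mapE /monomial_map raddf_sum /=; apply: eq_bigr => u _.
rewrite comp_mpolyZ -/(monomial_map _ _) monomial_mapX; congr (_ *: 'X_[_]).
apply/mnmP => j.
rewrite (big_morph _ (@exp_mapD _ _ m') (exp_map0 m')).
rewrite !mnm_sumE; apply: eq_bigr => i _; rewrite -vE.
elim: (u i) => [|k IH]; first by rewrite exp_map0.
by rewrite !mulmS exp_mapD !mnmDE IH.
Qed.

(** Deleting zeros and repetitions from [m] does not change the generated ring, so minimality says
    that nothing was deleted. *)
Lemma min_mon_generates_uniq s (m : s.-tuple 'X_{1..n}) :
  min_mon_generates S m -> uniq m /\ 0%MM \notin tval m.
Proof.
case=> gen min; pose r := undup (filter (predC1 0%MM) m).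
have memr x : (x \in in_tuple r) = (x != 0%MM) && (x \in m).
  by rewrite mem_undup mem_filter.
have rE : r = m.
  apply: (min _ (in_tuple r)).
    exact: subseq_trans (undup_subseq _) (filter_subseq _ _).
  move=> f; rewrite gen; split=> -[g ->]; apply: monomial_map_factor => x.
    by rewrite memr => ->; case: eqP; [left|right].
  by rewrite memr => /andP[]; right.
by rewrite -rE undup_uniq mem_undup mem_filter /= eqxx.
Qed.

End Generators.

(** * Binomials in the ideal of 2-minors *)

Section DeterminantalIdeal.
Context (K : fieldType) (s p q : nat) (M : 'M[{mpoly K[s]}]_(p, q)).
Context (U : 'I_p -> 'I_q -> 'X_{1..s}) (MU : forall i j, M i j = 'X_[U i j]).

Lemma det_mxsub2 (f : 'I_2 -> 'I_p) (g : 'I_2 -> 'I_q) :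
  \det (mxsub f g M) =
    'X_[U (f 0) (g 0) + U (f 1) (g 1)] - 'X_[U (f 0) (g 1) + U (f 1) (g 0)].
Proof.
have l01 : lift 0 0 = 1 :> 'I_2 by apply/val_inj.
have l10 : lift 1 0 = 0 :> 'I_2 by apply/val_inj.
rewrite (expand_det_row _ 0) big_ord_recl big_ord1 /cofactor !det_mx11 !mxE.
by rewrite !l01 !l10 expr0 expr1 mul1r mulN1r mulrN !MU -!mpolyXD.
Qed.

(** The coefficient at [u] is 1, so some multiple of a minor contributes to it, and one of the two
    monomials of that minor divides ['X_[u]]. *)
Lemma det_ideal_binomial u v :
  u != v -> det_ideal 2 M ('X_[u] - 'X_[v]) ->
  exists i i' j j', (U i j + U i' j' <= u)%MM /\
    (U i j + U i' j' != U i j' + U i' j)%MM.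
Proof.
move=> uv [k [c [g [minor]]]] /(congr1 (fun f : {mpoly K[s]} => f@_u)).
rewrite mcoeffB !mcoeffX eqxx eq_sym (negPf uv) subr0 raddf_sum /= => sum1.
have [l cg_neq0] : exists l, (c l * g l)@_u != 0.
  apply/existsP; rewrite -negb_forall; apply/negP => /forallP cg0.
  move: sum1; rewrite big1 => [/eqP|l _]; first by rewrite oner_eq0.
  exact/eqP/cg0.
have [i [i' [j [j' glE]]]] : exists i i' j j',
    g l = 'X_[U i j + U i' j'] - 'X_[U i j' + U i' j].
  have [f [h [_ _ ->]]] := minor l.
  by exists (f 0), (f 1), (h 0), (h 1); rewrite det_mxsub2.
move: cg_neq0; rewrite glE => nz.
have neq : (U i j + U i' j' != U i j' + U i' j)%MM.
  by apply: contraNneq nz => ->; rewrite subrr mulr0 mcoeff0.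
have [z|/mcoeffMX_neq0 le] :=
  eqVneq (c l * 'X_[U i j + U i' j'])@_u 0; last first.
  by exists i, i', j, j'.
(* Otherwise the antidiagonal product contributes; exchanging the columns makes it the diagonal
   one. *)
exists i, i', j', j; split; last by rewrite eq_sym.
by move: nz; rewrite mulrBr mcoeffB z sub0r oppr_eq0 => /mcoeffMX_neq0.
Qed.

(* The minors lie in the kernel, so the images of the entries of [M] form a
   multiplicatively rank one array. *)
Lemma det_ideal_kernel_balanced n (m : s.-tuple 'X_{1..n}) :
    (forall f : {mpoly K[s]}, monomial_map m f = 0 <-> det_ideal 2 M f) ->
  forall i i' j j',
    (exp_map m (U i j) + exp_map m (U i' j') =
     exp_map m (U i j') + exp_map m (U i' j))%MM.
Proof.
move=> ker.
(* Minors select rows and columns in increasing order; the other orders follow by symmetry. *)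
have lt_case (i i' : 'I_p) (j j' : 'I_q) : (i < i')%N -> (j < j')%N ->
    (exp_map m (U i j) + exp_map m (U i' j') =
     exp_map m (U i j') + exp_map m (U i' j))%MM.
  move=> ii' jj'; rewrite -!exp_mapD; apply/(monomial_map_binomial_eq0 K)/ker.
  exists 1%N, (fun=> 1), (fun=> 'X_[U i j + U i' j'] - 'X_[U i j' + U i' j]).
  split=> [_|]; last by rewrite big_ord1 mul1r.
  pose f k (x y : 'I_k) (t : 'I_2) := if t == 0 then x else y.
  have fhomo k (x y : 'I_k) : (x < y)%N ->
      {homo f _ x y : t t' / (t < t')%N}.
    by move=> xy; case=> [[|[|t]] ?]; case=> [[|[|t']] ?].
  exists (f p i i'), (f q j j'); split; [exact: fhomo|exact: fhomo|].
  by rewrite det_mxsub2.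
move=> i i' j j'.
case: (ltngtP i i') => [ii'|ii'|/val_inj ->]; last exact: addmC.
  case: (ltngtP j j') => [jj'|jj'|/val_inj -> //]; first exact: lt_case.
  exact/esym/lt_case.
case: (ltngtP j j') => [jj'|jj'|/val_inj -> //].
  by rewrite addmC [RHS]addmC; apply/esym/lt_case.
by rewrite addmC [RHS]addmC; apply/lt_case.
Qed.

End DeterminantalIdeal.

(** * Irreducible exponents and quadratic relations *)

Section VeroneseMonoid.
Context (n : nat) (a : n.-tuple nat) (d : nat).

Definition wdvd (x : 'X_{1..n}) : bool := (d %| wdeg a x)%N.

(** The atoms of the monoid of Veronese exponents; every monomial generating set contains them. *)
Definition wdvd_irreducible (x : 'X_{1..n}) : Prop :=
  [/\ x != 0%MM, wdvd x & forall y z, wdvd y -> wdvd z -> (x = y + z)%MM ->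
    y = 0%MM \/ z = 0%MM].

Definition nonzero_splittings (x : 'X_{1..n}) (r : seq 'X_{1..n}) : Prop :=
  forall u v, wdvd u -> u != 0%MM -> v != 0%MM -> (u + v = x)%MM -> u \in r.

Context (K : fieldType) (s : nat) (m : s.-tuple 'X_{1..n}).
Context (min : min_mon_generates (veronese K a d) m).

Lemma wdvd_exp_map u : wdvd (exp_map m u).
Proof.
have: 'X_[exp_map m u] \in veronese K a d.
  by apply/min.1; exists 'X_[u]; rewrite monomial_mapX.
by rewrite inE msuppX /= andbT.
Qed.

Lemma exp_map_eq0 u : exp_map m u = 0%MM -> u = 0%MM.
Proof.
apply: contraPeq => /mnm_neq0P[i [v ->]]; rewrite exp_mapD exp_map1.
move=> /mnmD_eq0 mi0; have [_ /negP] := min_mon_generates_uniq min.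
by apply; rewrite -mi0 mem_tnth.
Qed.

(** Split a variable off [u]: its image is nonzero, so irreducibility forces the image of the rest,
    hence the rest, to be zero. *)
Lemma exp_map_irreducible u :
  wdvd_irreducible (exp_map m u) -> exists i, u = U_(i)%MM.
Proof.
case=> nz _ irr.
have /mnm_neq0P[i [v uE]] : u != 0%MM.
  by apply: contraNneq nz => ->; rewrite exp_map0.
exists i; have [|/exp_map_eq0/mnmP/(_ i)|/exp_map_eq0 v0] :=
    irr _ _ (wdvd_exp_map U_(i)%MM) (wdvd_exp_map v).
- by rewrite uE exp_mapD.
- by rewrite mnm1E mnm0E eqxx.
by rewrite uE v0 addm0.
Qed.

Lemma exp_map_irreducible_inj u v :
  wdvd_irreducible (exp_map m u) -> exp_map m u = exp_map m v -> u = v.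
Proof.
move=> irr uv; have [i uE] := exp_map_irreducible irr.
have [j vE] : exists j, v = U_(j)%MM by apply: exp_map_irreducible; rewrite -uv.
move: uv; rewrite uE vE !exp_map1.
by move/(tuple_uniqP _ (min_mon_generates_uniq min).1) ->.
Qed.

Lemma irreducible_exp_map x :
  wdvd_irreducible x -> exists i, x = exp_map m U_(i)%MM.
Proof.
move=> irr; have [u ux] : exists u, exp_map m u = x.
  by apply: (mem_exp_map min.1); rewrite inE msuppX /= andbT; case: irr.
have [i uE] : exists i, u = U_(i)%MM by apply: exp_map_irreducible; rewrite ux.
by exists i; rewrite -uE.
Qed.

Context (p q : nat) (M : 'M[{mpoly K[s]}]_(p, q)).
Context (U : 'I_p -> 'I_q -> 'X_{1..s}) (MU : forall i j, M i j = 'X_[U i j]).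
Context (U_neq0 : forall i j, U i j != 0%MM).
Context (ker :
  forall f : {mpoly K[s]}, monomial_map m f = 0 <-> det_ideal 2 M f).

Local Notation w i j := (exp_map m (U i j)).

Lemma wdvd_entry i j : wdvd (w i j) /\ w i j != 0%MM.
Proof.
split; first exact: wdvd_exp_map.
by apply: contraNneq (U_neq0 i j) => /exp_map_eq0 ->.
Qed.

(* [x] has only the two factorisations [y z] and [y' z'], so the binomial
   relation between them must itself be a minor of [M], and this fixes the
   images of the four entries involved. *)
Lemma quadric_minor x y z y' z' :
    wdvd_irreducible y -> wdvd_irreducible z ->
    wdvd_irreducible y' -> wdvd_irreducible z' ->
    y != y' -> y != z' -> (y + z = x)%MM -> (y' + z' = x)%MM ->
    nonzero_splittings x [:: y; z; y'; z'] ->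
  exists i i' j j', [/\ w i j = y, w i' j' = z &
    w i j' = y' /\ w i' j = z' \/ w i j' = z' /\ w i' j = y'].
Proof.
move=> yI zI y'I z'I yy' yz' yz y'z' spl.
have {}spl k l k' l' : (w k l + w k' l' = x)%MM ->
    [\/ w k l = y /\ w k' l' = z, w k l = z /\ w k' l' = y,
      w k l = y' /\ w k' l' = z' | w k l = z' /\ w k' l' = y'].
  move=> klx; have [dkl nkl] := wdvd_entry k l.
  have := spl _ _ dkl nkl (wdvd_entry k' l').2 klx; rewrite !inE.
  move: klx => /[swap] /or4P[]/eqP ->.
  - by rewrite -yz => /addmI; constructor 1.
  - by rewrite -yz addmC => /addIm; constructor 2.
  - by rewrite -y'z' => /addmI; constructor 3.
  - by rewrite -y'z' addmC => /addIm; constructor 4.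
have [iy yE] := irreducible_exp_map yI; have [iz zE] := irreducible_exp_map zI.
have [iy' y'E] := irreducible_exp_map y'I.
have [iz' z'E] := irreducible_exp_map z'I.
pose u := (U_(iy) + U_(iz))%MM; pose v := (U_(iy') + U_(iz'))%MM.
(* If [u = v], the variable over [y] would occur in [v], making [y] equal to [y'] or [z']. *)
have uv : u != v.
  apply: contra_neq yy' => uv.
  move: yz'; rewrite yE y'E z'E.
  have : v iy != 0%N by rewrite -uv mnmDE mnm1E eqxx.
  rewrite mnmDE !mnm1E; have [->|_] := eqVneq iy' iy; first by [].
  by have [->|] := eqVneq iz' iy; rewrite ?eqxx.
have : det_ideal 2 M ('X_[u] - 'X_[v]).
  apply/ker/monomial_map_binomial_eq0.
  by rewrite !exp_mapD -yE -zE -y'E -z'E yz.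
case/(det_ideal_binomial MU uv) => i [i' [j [j' [le neq]]]].
(* A product of two nonconstant entries has degree at least 2, the degree of [u], so the cofactor is
   trivial. *)
have uE : (U i j + U i' j')%MM = u.
  move: (submK le); set r := (_ - _)%MM => rE.
  suff r0 : r = 0%MM by rewrite -rE r0 add0m.
  apply/eqP; rewrite -mdeg_eq0; have := congr1 (@mdeg _) rE.
  rewrite !mdegD !mdeg1; have := U_neq0 i j; have := U_neq0 i' j'.
  rewrite -!mdeg_eq0; lia.
have wx : (w i j + w i' j')%MM = x by rewrite -exp_mapD uE exp_mapD -yE -zE.
have wx' := wx; rewrite (det_ideal_kernel_balanced MU ker) in wx'.
(* Irreducibles have unique preimages, so the same pair on both diagonals would make the minor
   vanish. *)
have same x1 x2 : wdvd_irreducible x1 -> wdvd_irreducible x2 ->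
    w i j = x1 /\ w i' j' = x2 ->
    w i j' = x1 /\ w i' j = x2 \/ w i j' = x2 /\ w i' j = x1 -> False.
  move=> I1 I2 [e1 e2] alt; move/eqP: neq; apply.
  case: alt => -[e3 e4]; last rewrite [RHS]addmC;
    by congr (_ + _)%MM; apply: exp_map_irreducible_inj; rewrite ?e1 ?e2 ?e3 ?e4.
case: (spl _ _ _ _ wx) => e1; case: (spl _ _ _ _ wx') => e2;
  try by [case: (same _ _ yI zI e1); tauto | case: (same _ _ zI yI e1); tauto
    | case: (same _ _ y'I z'I e1); tauto | case: (same _ _ z'I y'I e1); tauto].
(* The two diagonals now carry different pairs; permuting rows and columns puts [y] first. *)
all: by [exists i, i', j, j'; split; tauto | exists i', i, j', j; split; tauto
  | exists i, i', j', j; split; tauto | exists i', i, j, j'; split; tauto].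
Qed.

End VeroneseMonoid.

(** * Computations for weights (3,4,5) and degree 6 *)

Definition mon3 (a b c : nat) : 'X_{1..3} := [multinom [tuple a; b; c]].

Lemma mon3_eq a b c a' b' c' :
  (mon3 a b c == mon3 a' b' c') = [&& a == a', b == b' & c == c'].
Proof.
apply/eqP/and3P => [/(congr1 val)/(congr1 val) [-> -> ->] //|].
by case=> /eqP-> /eqP-> /eqP->.
Qed.

Lemma mon3P x : exists a b c, x = mon3 a b c.
Proof.
case: x => -[[|a [|b [|c []]]] sz] //; exists a, b, c.
by congr Multinom; apply: val_inj.
Qed.

Lemma mon3D a b c a' b' c' :
  (mon3 a b c + mon3 a' b' c')%MM = mon3 (a + a') (b + b') (c + c').
Proof. by apply/mnmP => -[[|[|[|?]]] ?]; rewrite mnmDE. Qed.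

Lemma mon3_0 : 0%MM = mon3 0 0 0.
Proof. by apply/mnmP => -[[|[|[|?]]] ?]; rewrite mnm0E. Qed.

Local Notation wdvd6 := (wdvd [tuple 3; 4; 5] 6).

Lemma wdvd_mon3 a b c : wdvd6 (mon3 a b c) = (6 %| 3 * a + 4 * b + 5 * c)%N.
Proof. by rewrite /wdvd /wdeg !big_ord_recl big_ord0 addn0 addnA. Qed.

Definition mon3E := (mon3D, mon3_0, wdvd_mon3, mon3_eq).

Local Notation irreducible := (wdvd_irreducible [tuple 3; 4; 5] 6).

(** Summands are bounded coordinatewise by [(a,b,c)], which leaves a bounded arithmetic check for
    [lia]. *)
Lemma mon3_irreducible a b c :
    (0 < a + b + c)%N -> (6 %| 3 * a + 4 * b + 5 * c)%N ->
    (forall x y z, x <= a -> y <= b -> z <= c -> 6 %| 3 * x + 4 * y + 5 * z ->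
      [|| x + y + z == 0 | x + y + z == a + b + c])%N ->
  irreducible (mon3 a b c).
Proof.
move=> abc0 dvd irr; split; rewrite ?mon3E //; first lia.
move=> u v; have [x [y [z ->]]] := mon3P u; have [x' [y' [z' ->]]] := mon3P v.
rewrite !mon3E => dvdu dvdv /eqP; rewrite mon3E => /and3P[ax by_ cz].
have : (x + y + z == 0) || (x + y + z == a + b + c) by apply: irr; lia.
by case/orP => ?; [left | right]; apply/eqP; rewrite mon3E; lia.
Qed.

Local Notation A := (mon3 2 0 0).
Local Notation B := (mon3 0 3 0).
Local Notation C := (mon3 1 1 1).
Local Notation D := (mon3 0 2 2).
Local Notation E := (mon3 1 0 3).

Lemma irreducibleA : irreducible A.
Proof. apply: mon3_irreducible => // x y z; lia. Qed.
Lemma irreducibleB : irreducible B.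
Proof. apply: mon3_irreducible => // x y z; lia. Qed.
Lemma irreducibleC : irreducible C.
Proof. apply: mon3_irreducible => // x y z; lia. Qed.
Lemma irreducibleD : irreducible D.
Proof. apply: mon3_irreducible => // x y z; lia. Qed.
Lemma irreducibleE : irreducible E.
Proof. apply: mon3_irreducible => // x y z; lia. Qed.

Lemma mon3_splittings a b c r :
    (forall x y z, x <= a -> y <= b -> z <= c -> 6 %| 3 * x + 4 * y + 5 * z ->
      0 < x + y + z < a + b + c -> mon3 x y z \in r)%N ->
  nonzero_splittings [tuple 3; 4; 5] 6 (mon3 a b c) r.
Proof.
move=> splr u v; have [x [y [z ->]]] := mon3P u.
have [x' [y' [z' ->]]] := mon3P v.
rewrite !mon3E => dvdu u0 v0 /eqP; rewrite mon3E => sum.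
by apply: splr; lia.
Qed.

(** The exponent is [A + D = C + C]. *)
Lemma splittings_AD :
  nonzero_splittings [tuple 3; 4; 5] 6 (mon3 2 2 2) [:: A; D; C; C].
Proof. by apply: mon3_splittings => x y z; rewrite !inE !mon3_eq; lia. Qed.

(** The exponent is [B + E = C + D]. *)
Lemma splittings_BE :
  nonzero_splittings [tuple 3; 4; 5] 6 (mon3 1 3 3) [:: B; E; C; D].
Proof. by apply: mon3_splittings => x y z; rewrite !inE !mon3_eq; lia. Qed.

Lemma splittings_AB :
  nonzero_splittings [tuple 3; 4; 5] 6 (mon3 2 3 0) [:: A; B].
Proof. by apply: mon3_splittings => x y z; rewrite !inE !mon3_eq; lia. Qed.

Theorem proposition4p1 (K : fieldType) :
  ~ admits_determinantal_presentation (veronese K [tuple 3; 4; 5] 6).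
Proof.
move=> [s [m [min [p [q [M [mon ker]]]]]]].
have ex_exp i j : exists u : 'X_{1..s}, u != 0%MM /\ M i j = 'X_[u].
  by have [u] := mon i j; exists u.
have /fin_all_exists[U MU] i := fin_all_exists (ex_exp i).
have U0 i j := (MU i j).1; have {}MU i j := (MU i j).2.
have balanced := det_ideal_kernel_balanced MU ker.
have [i [i' [j [j' [wA _ wCC]]]]] := quadric_minor min MU U0 ker
  irreducibleA irreducibleD irreducibleC irreducibleC
  isT isT (mon3D _ _ _ _ _ _) (mon3D _ _ _ _ _ _) splittings_AD.
(* Both alternatives agree, since [C] plays both [y'] and [z']. *)
have [wC wC'] : exp_map m (U i j') = C /\ exp_map m (U i' j) = C by tauto.
have [k [_ [l [_ [wB _ _]]]]] := quadric_minor min MU U0 ker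
  irreducibleB irreducibleE irreducibleC irreducibleD
  isT isT (mon3D _ _ _ _ _ _) (mon3D _ _ _ _ _ _) splittings_BE.
have AB := balanced i k j l; rewrite wA wB mon3D in AB.
have [d_il n_il] := wdvd_entry min U0 i l.
have [_ n_kj] := wdvd_entry min U0 k j.
have := splittings_AB d_il n_il n_kj (esym AB); rewrite !inE.
case/orP => /eqP w_il.
  have w_kj : exp_map m (U k j) = B.
    by move: AB; rewrite w_il -(mon3D 2 0 0 0 3 0) => /addmI.
  (* [A + w(k,j') = C + B] fails in the first coordinate: 2 plus a natural number is not 1. *)
  have := balanced i k j j'; rewrite wA wC w_kj => /mnmP/(_ 0).
  by rewrite !mnmDE.
(* Likewise for [A + w(i',l) = B + C]. *)
have := balanced i i' j l; rewrite wA wC' w_il => /mnmP/(_ 0).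
by rewrite !mnmDE.
Qed.
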